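(* Let $n\ge 1$ and let $p_1,\dots,p_n\ge 0$ be real numbers with $p_1+\dots+p_n=1$. Suppose key $1$ is kept in hand and keys $2,\dots,n$ are put at random into boxes $1,\dots,n$, key $j$ being put in the random box $f(j)$, in such a way that $\Pr(f(j)=i)=p_i$ for all $j\in\{2,\dots,n\}$ and $i\in\{1,\dots,n\}$. Suppose moreover that if we condition on the contents of a set of boxes, each key which is not in any of those is distributed between the remaining ones with probabilities proportional to the initial probabilities $p_i$. Precisely: for every $S\subseteq\{1,\dots,n\}$ and every possible outcome $C$ (of positive probability) of the contents $(f^{-1}(i))_{i\in S}$ of the boxes in $S$, for every key $j\in\{2,\dots,n\}$ that under $C$ is not in any box of $S$, and for every $b\in\{1,\dots,n\}\setminus S$, $$\Pr\bigl(f(j)=b\mid C\bigr)=\frac{p_b}{\sum_{c\notin S}p_c}.$$ Then the probability of unlocking all boxes in padlock solitaire is $p_1$.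
   Context: Padlock solitaire: there are $n$ locked boxes labeled $1,\dots,n$; key $j$ opens box $j$ and only box $j$. The player keeps key $1$, and each key $j\in\{2,\dots,n\}$ is locked in some box $f(j)\in\{1,\dots,n\}$. The content of box $i$ is the set of keys $f^{-1}(i)=\{j: f(j)=i\}$. The player opens box $1$ with key $1$ and takes all keys in it; then, as long as the player holds a key to a box that is still locked, the player opens such a box and takes all keys in it. Thus the set of boxes that get opened is the smallest set $O\subseteq\{1,\dots,n\}$ with $1\in O$ and such that $f(j)\in O$ implies $j\in O$, and all boxes are unlocked if and only if $O=\{1,\dots,n\}$. The keys are not assumed to be placed independently of each other. *)

(* Defs.v *)
From HB Require Import structures.
From mathcomp Require Import all_boot all_order all_algebra.
From mathcomp Require all_classical all_reals all_analysis.

Set Implicit Arguments.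
Unset Strict Implicit.
Unset Printing Implicit Defensive.

(* With n.+1 boxes, box b : 'I_n.+1 carries the label b + 1, so ord0 is box 1.
   Key 1 is kept in hand; the n keys 2, ..., n+1 that are hidden are indexed by
   'I_n, key j being the one that opens box lift ord0 j. *)

Definition placement (n : nat) := {ffun 'I_n -> 'I_n.+1}.

Definition box_content (n : nat) (f : placement n) (i : 'I_n.+1) : {set 'I_n} :=
  [set j | f j == i].

Definition opening_closed (n : nat) (f : placement n) (O : {set 'I_n.+1}) :=
  (ord0 \in O) && [forall j : 'I_n, (f j \in O) ==> (lift ord0 j \in O)].

(* The smallest opening_closed set, see opened_closed and opened_min. *)
Definition opened (n : nat) (f : placement n) : {set 'I_n.+1} :=
  \bigcap_(O : {set 'I_n.+1} | opening_closed f O) O.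

Definition all_unlocked (n : nat) (f : placement n) : Prop :=
  opened f = [set: 'I_n.+1].

Lemma opened_closed (n : nat) (f : placement n) : opening_closed f (opened f).
Proof.
apply/andP; split; first by apply/bigcapP => O /andP[].
apply/forallP => j; apply/implyP => /bigcapP fjO; apply/bigcapP => O cO.
by have /andP[_ /forallP/(_ j)/implyP] := cO; apply; exact: fjO.
Qed.

Lemma opened_min (n : nat) (f : placement n) (O : {set 'I_n.+1}) :
  opening_closed f O -> opened f \subset O.
Proof. by move=> cO; exact: bigcap_inf. Qed.

Import all_classical all_reals all_analysis.
Local Open Scope classical_set_scope.
Local Open Scope ring_scope.

(* Pr(A | C), meaningful when 0 < P C *)
Definition cond_pr (d : measure_display) (T : measurableType d) (R : realType)
    (P : probability T R) (A C : set T) : R :=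
  fine (P (A `&` C)) / fine (P C).

(* The random placement f is measurable for the discrete sigma-algebra. *)
Definition random_placement (d : measure_display) (T : measurableType d)
    (n : nat) (f : T -> placement n) : Prop :=
  forall (j : 'I_n) (i : 'I_n.+1), measurable [set w | f w j = i].

Definition contents_are (d : measure_display) (T : measurableType d)
    (n : nat) (f : T -> placement n) (S : {set 'I_n.+1})
    (C : 'I_n.+1 -> {set 'I_n}) : set T :=
  [set w | forall i, i \in S -> box_content (f w) i = C i].

(* Main.v *)
Require Import Defs.
From HB Require Import structures.
From mathcomp Require Import all_boot all_order all_algebra.
From mathcomp Require Import ring.
Set Implicit Arguments.
Unset Strict Implicit.
Unset Printing Implicit Defensive.
Import Order.TTheory GRing.Theory Num.Theory.
Local Open Scope ring_scope.

(** Open the boxes one at a time, always a locked box whose key has been found,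
    and look at S, the set of boxes opened so far.  A key is missing while it
    lies in a box outside S.  The ratio

      (weight of the boxes with a missing key) / (weight of the boxes not in S)

    is a martingale: when box k is opened, the denominator q drops to q - p_k,
    and, by the conditioning hypothesis, each missing key stays missing with
    probability 1 - p_k / q = (q - p_k) / q, so the mean of the numerator drops
    by the same factor ([mean_missing_weight]).  When the exploration stops, the
    found keys are those of the boxes in S and no other box will be opened
    ([explored_stuck]), so the ratio is 1 if some box is still locked and 0
    otherwise.  The probability of losing is thus the initial value of the
    ratio, 1 - p_1.

    The stopping argument is replaced by an induction on the number of locked
    boxes: [losing_mass] says that, given the contents of S, the conditional
    probability of losing is the ratio.  Some care is needed when the locked
    boxes have weight 0.  A key still missing would then lie in each locked box
    with probability 0, so this has probability 0 ([mass_agree_eq0]), and the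
    convention x / 0 = 0 gives the ratio the correct value.

    Only the law of the random placement matters, so the argument is about a
    weight function on the finite type of placements; the probability space
    comes in at the end, through [probability_law]. *)

(** * Exploring the boxes of one placement *)

Section Exploration.
Variable n : nat.
Implicit Types (S : {set 'I_n.+1}) (g h : placement n).

Definition keys_found S g : {set 'I_n.+1} :=
  ord0 |: [set lift ord0 j | j in [set j | g j \in S]].

Definition agree S g h : bool :=
  [forall (i | i \in S), box_content g i == box_content h i].

(** The sets S that can occur as the set of opened boxes at some moment when the
    contents are those of g.  The second conjunct speaks of every h that agrees
    with g on S because the exploration up to S looks at nothing else. *)
Definition explored S g : Prop :=
  S \subset keys_found S g /\ forall h, agree S g h -> S \subset opened h.

Lemma lift_keys_found S g (j : 'I_n) :
  (lift ord0 j \in keys_found S g) = (g j \in S).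
Proof.
rewrite in_setU1 eq_sym (negbTE (neq_lift _ _)) /=.
by rewrite (mem_imset _ _ (@lift_inj _ ord0)) inE.
Qed.

Lemma ord0_keys_found S g : ord0 \in keys_found S g.
Proof. exact: setU11. Qed.

Lemma agree_content S g h i : agree S g h -> i \in S ->
  forall j, (g j == i) = (h j == i).
Proof.
move=> /forall_inP/(_ i)/[apply]/eqP/setP ghi j.
by have := ghi j; rewrite !inE.
Qed.

Lemma agree_mem S g h j : agree S g h -> (g j \in S) = (h j \in S).
Proof.
move=> gh; apply/idP/idP => jS.
  by have := agree_content gh jS j; rewrite eqxx => /esym/eqP->.
by have := agree_content gh jS j; rewrite eqxx => /eqP->.
Qed.

Lemma agree_eqr S g h : agree S g h -> agree S h =1 agree S g.
Proof.
move=> /forall_inP gh f; apply: eq_forallb_in => i iS.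
by rewrite (eqP (gh i iS)).
Qed.

(** Opening box k splits a class of the relation agree S according to the
    content of k; this is what makes the induction on S possible. *)
Lemma agree_setU1 k S g h :
  agree (k |: S) g h = agree S g h && (box_content h k == box_content g k).
Proof.
apply/forall_inP/andP => [gh|[/forall_inP gh /eqP kE] i].
  split; last by rewrite eq_sym gh ?setU11.
  by apply/forall_inP => i iS; rewrite gh// setU1r.
by rewrite in_setU1 => /predU1P[->|/gh//]; rewrite kE.
Qed.

Lemma keys_found_agree S g h :
  agree S g h -> keys_found S g = keys_found S h.
Proof.
move=> gh; congr (_ |: _).
suff -> : [set j | g j \in S] = [set j | h j \in S] by [].
by apply/setP => j; rewrite !inE (agree_mem _ gh).
Qed.

Lemma keys_found_opened S g :
  S \subset opened g -> keys_found S g \subset opened g.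
Proof.
have /andP[op0 /forallP opS] := opened_closed g.
move=> /subsetP SO; apply/subsetP => i /setU1P[->//|].
by move=> /imsetP[j]; rewrite inE => /SO gj ->; exact: (implyP (opS j)).
Qed.

Lemma keys_found_sub k S g : keys_found S g \subset keys_found (k |: S) g.
Proof.
apply/setUS/imsetS/subsetP => j; rewrite !inE => ->; exact: orbT.
Qed.

Lemma explored0 g : explored set0 g.
Proof. by split => [|h _]; exact: sub0set. Qed.

Lemma explored_setU1 k S g h : explored S g -> agree S g h ->
  k \in keys_found S g -> explored (k |: S) h.
Proof.
move=> [SK SO] gh kK; split.
  apply: subset_trans (keys_found_sub k S h).
  by rewrite -(keys_found_agree gh) subUset sub1set kK.
move=> f; rewrite agree_setU1 (agree_eqr gh) => /andP[gf _].
rewrite subUset SO// sub1set andbT.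
by apply: (subsetP (keys_found_opened (SO f gf))); rewrite -(keys_found_agree gf).
Qed.

(** With no key left to use, S is closed under opening, so it contains the least
    closed set. *)
Lemma explored_stuck S g h : explored S g -> keys_found S g \subset S ->
  agree S g h -> opened h = S.
Proof.
move=> [_ SO] KS gh; apply/eqP; rewrite eqEsubset SO// andbT.
apply: opened_min; apply/andP; split.
  exact: (subsetP KS _ (ord0_keys_found S g)).
apply/forallP => j; apply/implyP; rewrite -(agree_mem _ gh) => gj.
by apply: (subsetP KS); rewrite lift_keys_found.
Qed.

End Exploration.

(** * The probability of losing, given the contents of some boxes *)

Section Mass.
Variables (R : realFieldType) (n : nat) (p : 'I_n.+1 -> R).
Variable mu : placement n -> R.
Hypothesis p_ge0 : forall i, 0 <= p i.
Implicit Types (S : {set 'I_n.+1}) (g h : placement n).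

Definition mass (A : pred (placement n)) : R := \sum_(g | A g) mu g.
Definition locked_weight S : R := \sum_(i | i \notin S) p i.
Definition missing_weight S g : R := \sum_(j | g j \notin S) p (lift ord0 j).

(** The law of a missing key given the contents of S, multiplied by the mass of
    the class so that it also holds for classes of mass 0. *)
Hypothesis mass_cond : forall S g (j : 'I_n) b, g j \notin S -> b \notin S ->
  mass [pred h | agree S g h & h j == b] =
  p b / locked_weight S * mass (agree S g).

Lemma locked_weight_setU1 k S : k \notin S ->
  locked_weight S = p k + locked_weight (k |: S).
Proof.
move=> kS; rewrite /locked_weight (bigD1 k)//=; congr (_ + _).
by apply: eq_bigl => i; rewrite in_setU1 negb_or andbC.
Qed.

Lemma locked_weight_ge0 S : 0 <= locked_weight S.
Proof. exact: sumr_ge0. Qed.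

Lemma missing_weight_keys S g :
  missing_weight S g = locked_weight (keys_found S g).
Proof.
rewrite /missing_weight /locked_weight [RHS]big_mkcond big_ord_recl.
rewrite ord0_keys_found /= add0r big_mkcond; apply: eq_bigr => j _.
by rewrite lift_keys_found.
Qed.

Lemma missing_weight_ge0 S g : 0 <= missing_weight S g.
Proof. exact: sumr_ge0. Qed.

(** Besides A = S, this is needed when A also contains a box that is about to be
    opened, whose key is found but whose content is not yet known. *)
Lemma missing_weight_le (A : {set 'I_n.+1}) S g :
  A \subset keys_found S g -> missing_weight S g <= locked_weight A.
Proof.
move=> AK; rewrite missing_weight_keys /locked_weight big_mkcond.
rewrite [leRHS]big_mkcond; apply: ler_sum => i _.
have := subsetP AK i; case: (i \in A) => [-> //|_] /=.
by case: (i \in _) => //=.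
Qed.

Lemma missing_weight_agree S g h :
  agree S g h -> missing_weight S g = missing_weight S h.
Proof. by move=> gh; apply: eq_bigl => j; rewrite (agree_mem _ gh). Qed.

(** A missing key lies in some box outside S; if these boxes have weight 0,
    each of the possibilities has mass 0. *)
Lemma mass_agree_eq0 S g j : g j \notin S -> locked_weight S = 0 ->
  mass (agree S g) = 0.
Proof.
move=> gj q0; rewrite /mass (partition_big (fun h => h j) (fun b => b \notin S)).
  apply: big1 => b bS; rewrite -[LHS]/(mass [pred h | agree S g h & h j == b]).
  by rewrite mass_cond// q0 invr0 mulr0 mul0r.
by move=> h gh; rewrite -(agree_mem _ gh).
Qed.

(** The martingale step: each key missing from S survives the opening of box k
    with conditional probability 1 - p k / locked_weight S.  As the
    numerator is a sum over the keys, only the conditional law of each single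
    key enters, however the keys depend on each other. *)
Lemma mean_missing_weight k S g : k \notin S ->
  \sum_(h | agree S g h) mu h * missing_weight (k |: S) h =
  (1 - p k / locked_weight S) * missing_weight S g * mass (agree S g).
Proof.
move=> kS; pose P j := p (lift ord0 j).
transitivity (\sum_(h | agree S g h) \sum_(j | g j \notin S)
    P j * (mu h - if h j == k then mu h else 0)).
  apply: eq_bigr => h gh; rewrite /missing_weight mulr_sumr.
  rewrite big_mkcond [RHS]big_mkcond; apply: eq_bigr => j _.
  rewrite in_setU1 negb_or -(agree_mem _ gh).
  case: (h j == k); case: (g j \in S) => //=.
    by rewrite subrr mulr0.
  by rewrite subr0 mulrC.
rewrite exchange_big -mulrA mulrCA mulr_suml; apply: eq_bigr => j gj.
rewrite -mulr_sumr sumrB -big_mkcondr -/(mass (agree S g)).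
rewrite -[X in _ - X]/(mass [pred h | agree S g h & h j == k]).
by rewrite mass_cond// mulrBl mul1r.
Qed.

(** By induction on the number of locked boxes, with [mean_missing_weight] as
    the induction step: the losing probability averages the values of the ratio
    after one more box has been opened. *)
Lemma losing_mass S g : explored S g ->
  mass [pred h | agree S g h & opened h != [set: 'I_n.+1]] =
  missing_weight S g / locked_weight S * mass (agree S g).
Proof.
have [m] := ubnP #|~: S|; elim: m S g => // m IHm S g Sm eS.
have [KS|[k /setDP[kK kS]]] := set_0Vmem (keys_found S g :\: S).
  (* No usable key: the game is over, and the ratio is 0 or 1. *)
  have {KS}KS : keys_found S g = S.
    by apply/eqP; rewrite eqEsubset eS.1 -setD_eq0 KS eqxx.
  rewrite missing_weight_keys KS.
  have [ST|ST] := eqVneq S setT.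
    rewrite {1}/locked_weight big_pred0 => [|i]; last by rewrite ST in_setT.
    rewrite mul0r mul0r; apply: big1 => h /andP[gh].
    by rewrite (explored_stuck eS _ gh) ?KS// ST eqxx.
  have -> : mass [pred h | agree S g h & opened h != [set: 'I_n.+1]]
          = mass (agree S g).
    apply: eq_bigl => h /=; apply: andb_idr => gh.
    by rewrite (explored_stuck eS _ gh) ?KS.
  (* Boxes of weight 0 may stay locked, but only in a class of mass 0. *)
  have [q0|q0] := eqVneq (locked_weight S) 0; last by rewrite divff// mul1r.
  rewrite q0 mul0r mul0r.
  have [i] : exists i, i \notin S.
    apply/existsP; rewrite -negb_forall; apply: contra ST => /forallP ST.
    by apply/eqP/setP => i; rewrite in_setT ST.
  rewrite -{1}KS; case: (unliftP ord0 i) => [j ->|->]; last first.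
    by rewrite ord0_keys_found.
  by rewrite lift_keys_found => gj; exact: mass_agree_eq0 gj q0.
have qE := locked_weight_setU1 kS.
(* Open box k: the induction hypothesis applies to each possible content D. *)
have rec : mass [pred h | agree S g h & opened h != [set: 'I_n.+1]] =
  (\sum_(h | agree S g h) mu h * missing_weight (k |: S) h)
    / locked_weight (k |: S).
  rewrite /mass mulr_suml.
  rewrite (partition_big (fun h => box_content h k) predT)//=.
  rewrite [RHS](partition_big (fun h => box_content h k) predT)//=.
  apply: eq_bigr => D _.
  have [/existsP[h /andP[gh /eqP <-]]|/existsPn noD] :=
    boolP [exists h, agree S g h && (box_content h k == D)]; last first.
    rewrite !big_pred0// => h; first exact: negbTE (noD h).
    by rewrite andbAC (negbTE (noD h)).
  have agk f : agree S g f && (box_content f k == box_content h k) =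
               agree (k |: S) h f.
    by rewrite agree_setU1 (agree_eqr gh).
  transitivity (mass [pred f | agree (k |: S) h f & opened f != [set: 'I_n.+1]]).
    by apply: eq_bigl => f /=; rewrite andbAC agk.
  rewrite IHm; last 2 first.
  - rewrite -ltnS (leq_trans _ Sm)// ltnS; apply: proper_card.
    rewrite setCU properEneq subsetIr andbT; apply/eqP => /setP/(_ k).
    by rewrite !inE eqxx kS.
  - exact: explored_setU1 eS gh kK.
  rewrite mulr_sumr (eq_bigl _ _ agk); apply: eq_bigr => f hf.
  by rewrite (missing_weight_agree hf) mulrC mulrA.
have [q'0|q'0] := eqVneq (locked_weight (k |: S)) 0.
  (* A missing key opens a box outside S other than k, and these weigh 0. *)
  suff -> : missing_weight S g = 0 by rewrite rec q'0 invr0 mulr0 !mul0r.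
  apply/le_anti; rewrite missing_weight_ge0 andbT -q'0.
  by apply: missing_weight_le; rewrite subUset sub1set kK eS.1.
have q0 : locked_weight S != 0.
  by rewrite qE paddr_eq0 ?locked_weight_ge0// negb_and q'0 orbT.
rewrite rec mean_missing_weight//; apply: (mulIf q'0); rewrite mulfVK//.
have -> : locked_weight (k |: S) = locked_weight S - p k.
  by rewrite qE addrC addKr.
by field.
Qed.

(** Before the first move only the key of box ord0 is not missing. *)
Lemma winning_mass : \sum_i p i = 1 -> \sum_g mu g = 1 ->
  mass [pred g | opened g == [set: 'I_n.+1]] = p ord0.
Proof.
move=> p1 mu1; pose g0 : placement n := [ffun=> ord0].
have agree0 g : agree set0 g0 g by apply/forall_inP => i; rewrite in_set0.
have := losing_mass (explored0 g0).
have -> : mass (agree set0 g0) = 1 by rewrite -mu1; apply: eq_bigl.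
have -> : locked_weight set0 = 1.
  by rewrite -p1; apply: eq_bigl => i; rewrite in_set0.
have -> : missing_weight set0 g0 = 1 - p ord0.
  rewrite -p1 big_ord_recl addrC addKr; apply: eq_bigl => j.
  by rewrite in_set0.
rewrite divr1 mulr1 => losing; apply: (addIr (1 - p ord0)).
rewrite subrKC -losing -mu1 (bigID [pred g | opened g == [set: 'I_n.+1]])/=.
by congr (_ + _); apply: eq_bigl => g; rewrite /= agree0.
Qed.

End Mass.

From mathcomp Require Import all_classical all_reals all_analysis.
Local Open Scope classical_set_scope.

(** * The law of a random placement *)

Section Law.
Context (d : measure_display) (T : measurableType d) (R : realType).
Variables (P : probability T R) (n : nat) (f : T -> placement n).
Hypothesis f_random : random_placement f.

Definition law (g : placement n) : R := fine (P [set w | f w = g]).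

Lemma measurable_placement g : measurable [set w | f w = g].
Proof.
have -> : [set w | f w = g] = \bigcap_(j in [set: 'I_n]) [set w | f w j = g j].
  apply/seteqP; split => [w /= fg j _|w fg] /=; first by rewrite fg.
  apply/ffunP => j; exact: fg.
by apply: fin_bigcap_measurable => [|j _]; [exact: finite_finset|exact: f_random].
Qed.

Lemma law_ge0 g : 0 <= law g.
Proof. exact/fine_ge0/measure_ge0. Qed.

Lemma probability_law (A : pred (placement n)) :
  P [set w | A (f w)] = (mass law A)%:E.
Proof.
have -> : [set w | A (f w)] = \bigcup_(g in [set g | A g]) [set w | f w = g].
  apply/seteqP; split => [w Aw|w [g Ag fg]]; first by exists (f w).
  by rewrite /= fg.
rewrite measure_fin_bigcup.
- rewrite -(bigfs _ (index_enum_uniq (placement n))) => [|g _]; last first.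
    by rewrite mem_index_enum.
  rewrite -sumEFin; apply: eq_bigr => g _.
  by rewrite fineK// fin_num_measure//; exact: measurable_placement.
- exact: finite_finset.
- by apply/trivIsetP => g h _ _ /eqP gh; apply/seteqP; split => // w /= [-> /gh].
- by move=> g _; exact: measurable_placement.
Qed.

Lemma sum_law : \sum_g law g = 1.
Proof.
apply: EFin_inj; rewrite -[LHS](probability_law predT).
by rewrite -(@probability_setT _ _ _ P); congr (P _); apply/seteqP.
Qed.

Lemma contents_are_agree (S : {set 'I_n.+1}) (g : placement n) :
  contents_are f S (box_content g) = [set w | agree S g (f w)].
Proof.
apply/seteqP; split => w /= gw; first by apply/forall_inP => i iS; rewrite gw.
by move=> i /(forall_inP gw)/eqP.
Qed.

(** The hypothesis on conditional probabilities, in the product form used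
    above.  Outcomes of the contents are represented by placements g, which is
    enough because an outcome of positive probability is that of some g. *)
Lemma law_cond (p : 'I_n.+1 -> R) (S : {set 'I_n.+1}) (g : placement n)
    (j : 'I_n) (b : 'I_n.+1) :
  (forall (C : 'I_n.+1 -> {set 'I_n}),
    (0%:E < P (contents_are f S C))%E ->
    (forall i, i \in S -> j \notin C i) ->
    cond_pr P [set w | f w j = b] (contents_are f S C) =
      p b / \sum_(c < n.+1 | c \notin S) p c) ->
  g j \notin S ->
  mass law [pred h | agree S g h & h j == b] =
  p b / locked_weight p S * mass law (agree S g).
Proof.
move=> fc gj; set q := mass _ (agree S g).
have [q_le0|q_gt0] := leP q 0.
  have q0 : q = 0.
    by apply/le_anti; rewrite q_le0 sumr_ge0// => h _; exact: law_ge0.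
  rewrite q0 mulr0; apply/le_anti; rewrite -{1}q0 /q /mass.
  rewrite sumr_ge0 ?andbT => [|h _]; last exact: law_ge0.
  rewrite big_mkcondr; apply: ler_sum => h _.
  by case: ifP => // _; exact: law_ge0.
have := fc (box_content g).
rewrite contents_are_agree probability_law lte_fin => /(_ q_gt0) <-; last first.
  by move=> i iS; rewrite inE; apply: contraNneq gj => ->.
rewrite /cond_pr.
have -> : [set w | f w j = b] `&` [set w | agree S g (f w)] =
    [set w | [pred h | agree S g h & h j == b] (f w)].
  by apply/seteqP; split => w /= => [[<- ->]|/andP[-> /eqP]]//=; rewrite eqxx.
by rewrite !probability_law/= divfK// gt_eqF.
Qed.

End Law.

Theorem theorem7 (R : realType) (n : nat) (p : 'I_n.+1 -> R)
    (p_ge0 : forall i, 0 <= p i)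
    (p_sum1 : \sum_(i < n.+1) p i = 1)
    (d : measure_display) (T : measurableType d) (P : probability T R)
    (f : T -> placement n) (f_random : random_placement f)
    (f_distr : forall (j : 'I_n) (i : 'I_n.+1),
        P [set w | f w j = i] = (p i)%:E)
    (f_cond : forall (S : {set 'I_n.+1}) (C : 'I_n.+1 -> {set 'I_n}),
        (0%:E < P (contents_are f S C))%E ->
        forall j : 'I_n, (forall i, i \in S -> j \notin C i) ->
        forall b : 'I_n.+1, b \notin S ->
        cond_pr P [set w | f w j = b] (contents_are f S C) =
          p b / \sum_(c < n.+1 | c \notin S) p c) :
  P [set w | all_unlocked (f w)] = (p ord0)%:E.
Proof.
have -> : [set w | all_unlocked (f w)] =
    [set w | [pred g | opened g == [set: 'I_n.+1]%SET] (f w)].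
  by apply/seteqP; split => w /= /eqP.
rewrite probability_law// (winning_mass p_ge0)//; last exact: sum_law.
move=> S g j b gj bS; apply: law_cond => // C C_gt0 jC.
exact: f_cond.
Qed.
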